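(* Let $h\in SO_{2m+1}(F)$ be semisimple. Then there is a $Y\in GL_{2m+1}(F)$ and an $X\in M_{2m+1}(F)$ such that $Y+\tilde\varepsilon(Y)=XX'$ and $h=-(I-X'Y^{-1}X)$.
   Context: $F$ is a nonarchimedean local field of characteristic zero. $w=w_{2m+1}$ is the $(2m+1)\times(2m+1)$ antidiagonal matrix with all antidiagonal entries $1$, and $SO_{2m+1}(F)$ is the special orthogonal group of the symmetric form $w$. For $X,Y\in M_{2m+1}(F)$: $\tilde\varepsilon(Y)=w\,{}^tY\,w$ and $X'=-w\,{}^tX\,w$. *)

(* Defs.v *)
From mathcomp Require Import all_boot all_order all_algebra.

Set Implicit Arguments.
Unset Strict Implicit.
Unset Printing Implicit Defensive.

Import Order.TTheory GRing.Theory Num.Theory.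
Local Open Scope ring_scope.

(* [v x >= N], with the convention [v 0 = +oo]; the value that [v : F -> int]
   takes at 0 is thus never used. *)
Definition val_ge (F : fieldType) (v : F -> int) (x : F) (N : int) : bool :=
  (x == 0) || (N <= v x).

(* Normalized, so that the value group is the whole of [int]; in particular
   the trivial valuation is excluded. *)
Definition discrete_valuation (F : fieldType) (v : F -> int) : Prop :=
  [/\ forall x y, x != 0 -> y != 0 -> v (x * y) = v x + v y,
      forall x y N, val_ge v x N -> val_ge v y N -> val_ge v (x + y) N
    & exists2 pi, pi != 0 & v pi = 1].

Definition val_cauchy (F : fieldType) (v : F -> int) (u : nat -> F) : Prop :=
  forall N : int, exists n0 : nat, forall p q : nat,
    (n0 <= p)%N -> (n0 <= q)%N -> val_ge v (u p - u q) N.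

Definition val_converges (F : fieldType) (v : F -> int) (u : nat -> F) (l : F)
    : Prop :=
  forall N : int, exists n0 : nat, forall p : nat,
    (n0 <= p)%N -> val_ge v (u p - l) N.

Definition val_complete (F : fieldType) (v : F -> int) : Prop :=
  forall u : nat -> F, val_cauchy v u -> exists l : F, val_converges v u l.

(* The quotient of {v >= 0} by {v >= 1} is finite: the list [s] meets every
   residue class. *)
Definition finite_residue_field (F : fieldType) (v : F -> int) : Prop :=
  exists s : seq F, forall x : F, val_ge v x 0 ->
    exists2 y, y \in s & val_ge v (x - y) 1.

Definition nonarchimedean_local_field (F : fieldType) : Prop :=
  exists v : F -> int,
    [/\ discrete_valuation v, val_complete v & finite_residue_field v].

Definition antidiag_mx (F : fieldType) (n : nat) : 'M[F]_n :=
  \matrix_(i, j) (j == rev_ord i)%:R.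

(* Membership in SO_n(F) for the form (x, y) |-> x^T w y on column vectors. *)
Definition special_orthogonal (F : fieldType) (n : nat) (h : 'M[F]_n) : Prop :=
  h^T *m antidiag_mx F n *m h = antidiag_mx F n /\ \det h = 1.

Definition algebraic_closure_of (F : fieldType) (L : closedFieldType)
    (iota : {rmorphism F -> L}) : Prop :=
  forall x : L, algebraicOver iota x.

(* Diagonalizable over an algebraic closure of F.  The closure is quantified
   existentially; any two are isomorphic over F. *)
Definition semisimple_mx (F : fieldType) (n : nat) (h : 'M[F]_n) : Prop :=
  exists (L : closedFieldType) (iota : {rmorphism F -> L}),
    algebraic_closure_of iota /\ diagonalizable (map_mx iota h).

Definition eps_tilde (F : fieldType) (n : nat) (Y : 'M[F]_n) : 'M[F]_n :=
  antidiag_mx F n *m Y^T *m antidiag_mx F n.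

Definition mx_prime (F : fieldType) (n : nat) (X : 'M[F]_n) : 'M[F]_n :=
  - (antidiag_mx F n *m X^T *m antidiag_mx F n).

(* Main.v *)
Require Import Defs.
From mathcomp Require Import all_boot all_order all_algebra.

Set Implicit Arguments.
Unset Strict Implicit.
Unset Printing Implicit Defensive.

Import Order.TTheory GRing.Theory Num.Theory.
Local Open Scope ring_scope.

(** Write [A*] for [eps_tilde A], the adjoint of [A] for the form [w], and put
    [N = - h - 1].  Orthogonality of [h] reads [N + N* = - N N*], and the
    equation for [h] reads [N = X* Y^-1 X].  Semisimplicity makes the range of
    [N] a complement of its kernel; let [P] be the projection onto the range
    along the kernel, which is self-adjoint.  Since [n] is odd and [det h = 1],
    the kernel (the eigenspace of [h] for [-1]) has even dimension, hence
    carries an invertible skew-adjoint operator [K].  Then [X = P] and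
    [Y = (N + K)^-1] are a solution. *)

Section Adjoint.
Variables (F : fieldType) (n : nat).
Implicit Types A B : 'M[F]_n.
Local Notation w := (antidiag_mx F n).

Lemma antidiag_mx_tr : w^T = w.
Proof.
by apply/matrixP=> i j; rewrite !mxE -(inj_eq rev_ord_inj) rev_ordK eq_sym.
Qed.

Lemma antidiag_mxK : w *m w = 1%:M.
Proof.
apply/matrixP=> i j; rewrite !mxE (bigD1 (rev_ord i)) //= !mxE eqxx mul1r.
rewrite rev_ordK big1 ?addr0 1?eq_sym // => k ne_ki.
by rewrite !mxE (negbTE ne_ki) mul0r.
Qed.

Lemma eps_tildeD A B : eps_tilde (A + B) = eps_tilde A + eps_tilde B.
Proof. by rewrite /eps_tilde linearD mulmxDr mulmxDl. Qed.

Lemma eps_tildeN A : eps_tilde (- A) = - eps_tilde A.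
Proof. by rewrite /eps_tilde linearN mulmxN mulNmx. Qed.

Lemma eps_tilde1 : eps_tilde 1%:M = 1%:M :> 'M[F]_n.
Proof. by rewrite /eps_tilde trmx1 mulmx1 antidiag_mxK. Qed.

Lemma eps_tildeM A B : eps_tilde (A *m B) = eps_tilde B *m eps_tilde A.
Proof.
rewrite /eps_tilde trmx_mul !mulmxA.
by rewrite -[_ *m w *m w]mulmxA antidiag_mxK mulmx1.
Qed.

Lemma eps_tildeK A : eps_tilde (eps_tilde A) = A.
Proof.
rewrite /eps_tilde !trmx_mul trmxK antidiag_mx_tr !mulmxA antidiag_mxK mul1mx.
by rewrite -mulmxA antidiag_mxK mulmx1.
Qed.

Lemma det_eps_tilde A : \det (eps_tilde A) = \det A.
Proof.
rewrite /eps_tilde !det_mulmx det_tr mulrAC -det_mulmx antidiag_mxK det1.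
exact: mul1r.
Qed.

End Adjoint.

(** Inverting the nonzero eigenvalues in an eigenbasis gives [C] with [A = C A A]. Semisimplicity is
    used in this form because an inclusion of row spaces descends from an algebraic closure to
    [F]. *)
Lemma diagonalizable_sub_square (F : fieldType) (n : nat) (A : 'M[F]_n) :
  diagonalizable A -> (A <= A *m A)%MS.
Proof.
case=> V uV /(similar_diagLR uV)[d ->]; rewrite conjVmx //.
(* The convention [0^-1 = 0] keeps [d^-1 * d * d = d] true at zero eigenvalues. *)
apply/submxP; exists (invmx V *m diag_mx (map_mx GRing.inv d) *m V).
rewrite !mulmxA !mulmxK //.
rewrite -2![in RHS](mulmxA (invmx V)) !mulmx_diag; congr (_ *m diag_mx _ *m _).
apply/rowP=> j; rewrite !mxE.
by have [->|nz] := eqVneq (d 0 j) 0; rewrite ?mulr0 // mulVf ?mul1r.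
Qed.

Lemma diagonalizableD_scalar (F : fieldType) (n : nat) (A : 'M[F]_n) (a : F) :
  diagonalizable A -> diagonalizable (A + a%:M).
Proof.
case=> V uV /(similar_diagLR uV)[d ->]; exists V => //.
apply/(similar_diagLR uV); exists (d + const_mx a).
rewrite !conjVmx // linearD /= diag_const_mx mulmxDr mulmxDl; congr (_ + _).
by rewrite scalar_mxC mulmxKV.
Qed.

(** Sylvester's identity: both sides are Schur complements of one block matrix. *)
Lemma det_mulmx_swap (R : comPzRingType) (n r : nat)
    (A : 'M[R]_(n, r)) (B : 'M[R]_(r, n)) :
  \det (1%:M - A *m B) = \det (1%:M - B *m A).
Proof.
transitivity (\det (block_mx 1%:M A B 1%:M)).
- have -> : block_mx 1%:M A B 1%:M =
    block_mx 1%:M A 0 1%:M *m block_mx (1%:M - A *m B) 0 B 1%:M.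
    by rewrite mulmx_block !(mul1mx, mulmx1, mul0mx, mulmx0, add0r, subrK).
  by rewrite det_mulmx det_ublock det_lblock !det1 !mul1r mulr1.
- have -> : block_mx 1%:M A B 1%:M =
    block_mx 1%:M 0 B 1%:M *m block_mx 1%:M A 0 (1%:M - B *m A).
    by rewrite mulmx_block !(mul1mx, mulmx1, mul0mx, mulmx0, addr0) addrC subrK.
  by rewrite det_mulmx det_ublock det_lblock !det1 !mul1r.
Qed.

(** A rank factorization [Q = C R] of an idempotent has [R C = 1], so swapping the factors leaves
    the determinant of the scalar [1 - 2 = -1] in size [\rank Q]. *)
Lemma det_reflection (F : fieldType) (n : nat) (Q : 'M[F]_n) :
  Q *m Q = Q -> \det (1%:M - Q *+ 2) = (-1) ^+ \rank Q.
Proof.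
set r := \rank Q => QQ.
have RC : row_base Q *m col_base Q = 1%:M.
  apply: (row_full_inj (col_base_full Q)).
  apply: (row_free_inj (row_base_free Q)).
  by rewrite /= mulmx1 mulmxA -mulmxA !mulmx_base.
have -> : Q *+ 2 = (col_base Q *+ 2) *m row_base Q.
  by rewrite mulr2n mulmxDl mulmx_base.
rewrite det_mulmx_swap mulr2n mulmxDr RC opprD addrA subrr sub0r.
by rewrite -raddfN det_scalar.
Qed.

Section SkewOperator.
Variables (F : fieldType) (n : nat).

Definition symplectic_mx (k : nat) : 'M[F]_(k + k) :=
  block_mx 0 1%:M (- 1%:M) 0.

Lemma symplectic_mx_tr k : (symplectic_mx k)^T = - symplectic_mx k.
Proof.
by rewrite tr_block_mx opp_block_mx linearN /= !trmx0 trmx1 !oppr0 opprK.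
Qed.

Lemma symplectic_mx_unit k : symplectic_mx k \in unitmx.
Proof.
suff /mulmx1_unit[] : symplectic_mx k *m - symplectic_mx k = 1%:M by [].
rewrite opp_block_mx mulmx_block !oppr0 opprK !(mul0mx, mulmx0) !mul1mx.
by rewrite mulmxN mulmx1 opprK !addr0 !add0r -scalar_mx_block.
Qed.

(* On the even-dimensional space of rows [v] with [v Q = v], transport a
   symplectic form through the Gram matrix of [w]. *)
Lemma skew_adjoint_exists (Q : 'M[F]_n) :
    Q *m Q = Q -> eps_tilde Q = Q -> ~~ odd (\rank Q) ->
  exists K : 'M[F]_n, [/\ eps_tilde K = - K, K *m Q = K
    & forall u : 'rV_n, u *m K = 0 -> u *m Q = 0].
Proof.
move=> QQ Qs Qev; pose w := antidiag_mx F n.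
have [k Dk] : exists k, \rank Q = (k + k)%N.
  by exists (\rank Q)./2; rewrite addnn even_halfK.
have [R [Rfree RQ [A QE]]] : exists R : 'M_(k + k, n),
    [/\ row_free R, R *m Q = R & exists A, Q = A *m R].
  rewrite -Dk; exists (row_base Q); rewrite row_base_free; split=> //.
    have /submxP[B ->] : (row_base Q <= Q)%MS by rewrite eq_row_base.
    by rewrite -mulmxA QQ.
  by apply/submxP; rewrite eq_row_base.
exists (w *m R^T *m symplectic_mx k *m R); split.
- rewrite /eps_tilde !trmx_mul symplectic_mx_tr trmxK antidiag_mx_tr.
  by rewrite !(mulNmx, mulmxN) !mulmxA -mulmxA antidiag_mxK mulmx1.
- by rewrite -mulmxA RQ.
- move=> u; rewrite !mulmxA => uK0.
  have uwR : u *m w *m R^T = 0.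
    apply: (@row_free_inj _ _ _ _ (symplectic_mx k)).
      by rewrite row_free_unit symplectic_mx_unit.
    by apply: (row_free_inj Rfree); rewrite /= !mul0mx.
  (* Self-adjointness gives [u Q = u w Q^T w = u w R^T A^T w]. *)
  rewrite -Qs /eps_tilde -/w [in Q^T]QE trmx_mul !mulmxA uwR.
  by rewrite !mul0mx.
Qed.

End SkewOperator.

Section Orthogonal.
Variables (F : fieldType) (n : nat) (N : 'M[F]_n).
Hypothesis NE : N + eps_tilde N = - (N *m eps_tilde N).
Local Notation adj := (@eps_tilde F n).

(** Hence any left identity for [N] is also one for [adj N]. *)
Lemma adjointE : adj N = - (N *m (1%:M + adj N)).
Proof. by rewrite mulmxDr mulmx1 opprD -NE addKr. Qed.

Lemma orthogonal1D : (1%:M + N) *m (1%:M + adj N) = 1%:M.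
Proof.
rewrite mulmxDl mul1mx [N *m _ in LHS]mulmxDr mulmx1 -[N *m _]opprK -NE.
by rewrite opprD addNKr addrK.
Qed.

(** [1 + N] and [1 + adj N] are mutually inverse, hence commute. *)
Lemma adjoint_normal : adj N *m N = N *m adj N.
Proof.
have := etrans (mulmx1C orthogonal1D) (esym orthogonal1D).
rewrite !mulmxDl !mul1mx !mulmxDr !mulmx1 !addrA.
by rewrite [1%:M + adj N + N]addrAC => /addrI.
Qed.

(** If [N = D N N], then [P = D N] fixes [N] from the left, hence also [adj N] and
    [adj P = adj N adj D]. So [adj P = P adj P], which is self-adjoint; thus [adj P = P] and
    [P P = P]. *)
Lemma range_projection : (N <= N *m N)%MS ->
  exists P : 'M[F]_n, [/\ P *m P = P, adj P = P, P *m N = N, N *m P = N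
    & exists B, P = N *m B].
Proof.
case/submxP=> D ND; set P := D *m N.
have PN : P *m N = N by rewrite -mulmxA -ND.
have PNs : P *m adj N = adj N.
  by rewrite {1}adjointE mulmxN mulmxA PN -adjointE.
have PPs : P *m adj P = adj P by rewrite eps_tildeM mulmxA PNs.
have Ps : adj P = P.
  by rewrite -PPs -{1}(eps_tildeK P) -eps_tildeM PPs eps_tildeK.
exists P; split=> //.
- by rewrite -{2}Ps PPs.
- by rewrite -[N in LHS]eps_tildeK -{1}Ps -eps_tildeM PNs eps_tildeK.
- exists (- ((1%:M + adj N) *m adj D)).
  by rewrite -{1}Ps eps_tildeM {1}adjointE mulmxN mulNmx -!(mulmxA N).
Qed.

(* With [Q = 1 - P], the adjoint of the invertible [N + Q] is [U (N + Q)] for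
   [U = Q - (1 + N* ) P], so [det U = 1], whereas [(1 + N) U] is the reflection
   [Q - P]. *)
Lemma kernel_rank_even (P : 'M[F]_n) :
    2%:R != 0 :> F -> odd n -> \det (1%:M + N) = -1 ->
    P *m P = P -> adj P = P -> P *m N = N -> N *m P = N ->
    (exists B, P = N *m B) ->
  ~~ odd (\rank (1%:M - P)).
Proof.
move=> nz2 odd_n detN PP Ps PN NP [B PE]; set Q := 1%:M - P.
have QP : Q *m P = 0 by rewrite mulmxBl mul1mx PP subrr.
have PQ : P *m Q = 0 by rewrite mulmxBr mulmx1 PP subrr.
have QQ : Q *m Q = Q by rewrite {2}/Q mulmxBr mulmx1 QP subr0.
have QN : Q *m N = 0 by rewrite mulmxBl mul1mx PN subrr.
have NQ : N *m Q = 0 by rewrite mulmxBr mulmx1 NP subrr.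
have uNQ : N + Q \in unitmx.
  rewrite -row_free_unit; apply/inj_row_free=> u; rewrite mulmxDr => u0.
  have uN : u *m N = 0.
    move/(congr1 (mulmx^~ P)): u0.
    by rewrite mulmxDl -!mulmxA NP QP mulmx0 addr0 mul0mx.
  have uP : u *m P = 0 by rewrite PE mulmxA uN mul0mx.
  by move: u0; rewrite uN add0r mulmxBr mulmx1 uP subr0.
have adjNQ : (Q - (1%:M + adj N) *m P) *m (N + Q) = adj (N + Q).
  rewrite mulmxBl !(mulmxDr _ N Q) QN QQ add0r -!mulmxA PN PQ mulmx0 addr0.
  rewrite eps_tildeD eps_tildeD eps_tildeN eps_tilde1 Ps addrC; congr (_ + _).
  (* By normality, [(1 + adj N) N = N + N adj N = - adj N]. *)
  by rewrite mulmxDl mul1mx adjoint_normal -[N *m _]opprK -NE opprB addrC addKr.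
have detU : \det (Q - (1%:M + adj N) *m P) = 1.
  apply: (mulIf (_ : \det (N + Q) != 0)).
    by rewrite -unitfE -unitmxE.
  by rewrite -det_mulmx adjNQ det_eps_tilde mul1r.
(* The reflection is [Q - P = - (1 - 2 Q)]; its sign contributes [(-1) ^+ n]. *)
have : \det (1%:M + N) = (-1) ^+ n * (-1) ^+ \rank Q.
  transitivity (\det ((1%:M + N) *m (Q - (1%:M + adj N) *m P))).
    by rewrite det_mulmx detU mulr1.
  rewrite mulmxBr mulmxA orthogonal1D mul1mx.
  rewrite mulmxDl mul1mx NQ addr0 -det_reflection // -detZ scaleN1r.
  congr (\det _); rewrite opprB mulr2n -[RHS]addrA; congr (_ + _).
  by rewrite /Q addrAC subrr sub0r.
rewrite detN -signr_odd odd_n expr1 mulN1r -signr_odd => /oppr_inj.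
case: odd => //= /eqP; rewrite expr1 -addr_eq0 -mulr2n => /eqP eq2.
by rewrite eq2 eqxx in nz2.
Qed.

End Orthogonal.

Theorem proposition2p7 (F : fieldType)
    (F_char0 : [pchar F] =i pred0)
    (F_local : nonarchimedean_local_field F)
    (m : nat) (h : 'M[F]_(2 * m + 1))
    (h_SO : special_orthogonal h) (h_semisimple : semisimple_mx h) :
  exists Y X : 'M[F]_(2 * m + 1),
    [/\ Y \in unitmx,
        Y + eps_tilde Y = X *m mx_prime X
      & h = - (1%:M - mx_prime X *m invmx Y *m X)].
Proof.
have nz2 : 2%:R != 0 :> F by rewrite ((pcharf0P F).1 F_char0).
case: h_SO => h_orth det_h.
have odd_n : odd (2 * m + 1) by rewrite addn1 /= mul2n odd_double.
have [N hE] : exists N, 1%:M + N = - h.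
  by exists (- h - 1%:M); rewrite addrC subrK.
have hh : eps_tilde h *m h = 1%:M.
  by rewrite /eps_tilde -!mulmxA (mulmxA h^T) h_orth antidiag_mxK.
have NE : N + eps_tilde N = - (N *m eps_tilde N).
  have : - h *m eps_tilde (- h) = 1%:M.
    by rewrite eps_tildeN mulNmx mulmxN opprK (mulmx1C hh).
  rewrite -hE eps_tildeD eps_tilde1 mulmxDl mul1mx mulmxDr mulmx1 => E.
  apply/eqP; rewrite -addr_eq0; apply/eqP; apply: (addrI 1%:M).
  by rewrite addr0 -[RHS]E !addrA [1%:M + N + _]addrAC.
(* Over the closure [h + 1 = - N] is diagonalizable along with [h]. *)
have subN : (N <= N *m N)%MS.
  have [L [iota [_ h_diag]]] := h_semisimple.
  have := diagonalizable_sub_square (diagonalizableD_scalar 1 h_diag).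
  have -> : map_mx iota h + 1%:M = map_mx iota (- N).
    rewrite -[h]opprK -hE opprD map_mxD map_mxN map_mx1.
    by rewrite addrAC addNr add0r.
  by rewrite -map_mxM map_submx mulmxN mulNmx opprK eqmx_opp.
have [P [PP Ps PN NP PE]] := range_projection NE subN.
have det_N : \det (1%:M + N) = -1.
  by rewrite hE -scaleN1r detZ det_h mulr1 -signr_odd odd_n.
have Qev := kernel_rank_even NE nz2 odd_n det_N PP Ps PN NP PE.
set Q := 1%:M - P in Qev.
have QQ : Q *m Q = Q.
  by rewrite {2}/Q mulmxBr mulmx1 mulmxBl mul1mx PP subrr subr0.
have Qs : eps_tilde Q = Q by rewrite eps_tildeD eps_tildeN eps_tilde1 Ps.
have [K [Ks KQ Kker]] := skew_adjoint_exists QQ Qs Qev.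
have KP : K *m P = 0 by rewrite -KQ -mulmxA mulmxBl mul1mx PP subrr mulmx0.
have PK : P *m K = 0.
  rewrite -[K]opprK -Ks -{1}Ps mulmxN -eps_tildeM KP.
  by rewrite /eps_tilde trmx0 mulmx0 mul0mx oppr0.
pose Z := N + K.
have ZP : Z *m P = N by rewrite mulmxDl NP KP addr0.
have uZ : Z \in unitmx.
  rewrite -row_free_unit; apply/inj_row_free=> u uZ0.
  have uN : u *m N = 0 by rewrite -ZP mulmxA uZ0 mul0mx.
  have uQ : u *m Q = 0 by apply: Kker; move: uZ0; rewrite mulmxDr uN add0r.
  have [B PB] := PE.
  by move: uQ; rewrite mulmxBr mulmx1 PB mulmxA uN mul0mx subr0.
exists (invmx Z), P; have P'E : mx_prime P = - P by rewrite -{2}Ps.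
have uZs : eps_tilde Z \in unitmx by rewrite unitmxE det_eps_tilde -unitmxE.
split.
- by rewrite unitmx_inv.
(* Multiplied by [Z] on the left and [eps_tilde Z] on the right, the equation becomes
   [eps_tilde Z + Z = - N eps_tilde Z]. Since [K] is skew and [N K = N P K = 0], this is [NE]. *)
- apply: (can_inj (mulKmx uZ)); apply: (can_inj (mulmxK uZs)).
  rewrite P'E mulmxDr mulmxDl mulmxV // mul1mx -[Z *m _ *m _]mulmxA.
  rewrite -eps_tildeM mulmxV // eps_tilde1 mulmx1 mulmxN PP mulmxN ZP mulNmx.
  have NK : N *m eps_tilde K = 0.
    by rewrite Ks mulmxN -NP -mulmxA PK mulmx0 oppr0.
  rewrite eps_tildeD mulmxDr NK addr0 -NE Ks addrACA [_ + N]addrC.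
  by rewrite addNr addr0.
(* Here [X' Y^-1 X = - P Z P = - P N = - N]. *)
- by rewrite invmxK P'E !mulNmx opprK -mulmxA ZP PN hE opprK.
Qed.
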